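(* Let $F\colon\mathcal Q\to\mathcal Q'$ be a strictly exact fully faithful functor between quasi-abelian categories with enough projectives. Suppose that $F$ has a left adjoint $F'$, and that for any $Q'\in\mathcal Q'$ there is $Q\in\mathcal Q$ and a strict epimorphism $F(Q)\to Q'$. Then the Quillen adjunction $F'_\bullet\colon\mathrm S\mathcal Q'\rightleftarrows\mathrm S\mathcal Q\colon F_\bullet$ induced degree-wise by $(F',F)$ on the categories of simplicial objects is a Quillen equivalence.
   Context: A quasi-abelian category is an additive category with finite limits and finite colimits in which pullbacks of strict epimorphisms (= cokernels) are strict epimorphisms and pushouts of strict monomorphisms (= kernels) are strict monomorphisms. A null sequence $Q_1\xrightarrow{f_1}Q_2\xrightarrow{f_2}Q_3$ is strictly exact if $Q_1\to\mathrm{Ker}(f_2)$ is a strict epimorphism. A functor between quasi-abelian categories is strictly exact if it maps strictly exact sequences $Q_1\to Q_2\to Q_3$ to strictly exact sequences. An object $P$ is projective if $\mathrm{hom}(P,-)$ maps strict epimorphisms to surjections; the category has enough projectives if every object is the target of a strict epimorphism from a projective object. For a quasi-abelian category $\mathcal Q$ with enough projectives, the category $\mathrm S\mathcal Q$ of simplicial objects carries the model structure in which $C_\bullet\to D_\bullet$ is a weak equivalence (fibration) if for every projective $P\in\mathcal Q$ the map of simplicial sets $\mathrm{hom}(P,C_\bullet)\to\mathrm{hom}(P,D_\bullet)$ (computed degree-wise) is a weak equivalence (Kan fibration). *)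

(* Defs.v *)
(* Categories have hom-types in a fixed universe, and morphisms are compared by
   [=]. *)
From mathcomp Require Import all_boot all_algebra.
From mathcomp Require Import boolp.
From Stdlib Require Import Relations.

Set Implicit Arguments.
Unset Strict Implicit.
Unset Printing Implicit Defensive.

Import GRing.Theory.

Record category := Category {
  ob :> Type;
  hom : ob -> ob -> Type;
  idm : forall a, hom a a;
  comp : forall a b c, hom b c -> hom a b -> hom a c;
  compm1 : forall a b (f : hom a b), comp f (idm a) = f;
  comp1m : forall a b (f : hom a b), comp (idm b) f = f;
  compA : forall a b c d (h : hom c d) (g : hom b c) (f : hom a b),
    comp h (comp g f) = comp (comp h g) f
}.

Notation "g \oC f" := (comp g f) (at level 40, left associativity).

Definition opposite (C : category) : category :=
  @Category C (fun a b => hom b a) (@idm C)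
    (fun a b c g f => f \oC g)
    (fun a b f => comp1m f) (fun a b f => compm1 f)
    (fun a b c d h g f => esym (compA f g h)).

Record functor (C D : category) := Functor {
  fobj :> C -> D;
  fmap : forall a b, hom a b -> hom (fobj a) (fobj b);
  fmap1 : forall a, fmap (idm a) = idm (fobj a);
  fmapD : forall a b c (g : hom b c) (f : hom a b),
    fmap (g \oC f) = fmap g \oC fmap f
}.
Arguments fmap {C D} f0 {a b} _.

Definition fully_faithful (C D : category) (F : functor C D) : Prop :=
  forall a b : C, bijective (@fmap C D F a b).

Definition fcomp (C D E : category) (G : functor D E) (F : functor C D) :
  functor C E.
Proof.
refine (@Functor C E (fun a => G (F a)) (fun a b f => fmap G (fmap F f)) _ _).
- by move=> a; rewrite !fmap1.
- by move=> a b c g f; rewrite !fmapD.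
Defined.

Record adjunction (C D : category) (L : functor D C) (R : functor C D) :=
  Adjunction {
  adj_fwd : forall (d : D) (c : C), hom (L d) c -> hom d (R c);
  adj_bwd : forall (d : D) (c : C), hom d (R c) -> hom (L d) c;
  adj_fwdK : forall d c, cancel (@adj_fwd d c) (@adj_bwd d c);
  adj_bwdK : forall d c, cancel (@adj_bwd d c) (@adj_fwd d c);
  adj_natl : forall (d' d : D) (c : C) (f : hom (L d) c) (g : hom d' d),
    adj_fwd (f \oC fmap L g) = adj_fwd f \oC g;
  adj_natr : forall (d : D) (c c' : C) (h : hom c c') (f : hom (L d) c),
    adj_fwd (h \oC f) = fmap R h \oC adj_fwd f
}.
Arguments adj_fwd {C D L R} _ {d c} _.
Arguments adj_bwd {C D L R} _ {d c} _.

Section Limits.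
Variable C : category.

Definition initial (z : C) : Prop := forall a, exists! f : hom z a, True.
Definition terminal (z : C) : Prop := forall a, exists! f : hom a z, True.

Definition is_cone (J : category) (D : functor J C) (l : C)
    (p : forall j : J, hom l (D j)) : Prop :=
  forall (i j : J) (u : hom i j), fmap D u \oC p i = p j.

Definition is_limit (J : category) (D : functor J C) (l : C)
    (p : forall j : J, hom l (D j)) : Prop :=
  is_cone p /\
  forall (m : C) (q : forall j : J, hom m (D j)), is_cone q ->
    exists! h : hom m l, forall j, p j \oC h = q j.

(*   d --g'--> a
     |         |
     f'        f
     v         v
     b --g---> c    *)
Definition is_pullback (a b c d : C) (f : hom a c) (g : hom b c)
    (g' : hom d a) (f' : hom d b) : Prop :=
  f \oC g' = g \oC f' /\
  forall (m : C) (u : hom m a) (v : hom m b), f \oC u = g \oC v ->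
    exists! h : hom m d, g' \oC h = u /\ f' \oC h = v.

(*   c --g---> b
     |         |
     f         f'
     v         v
     a --g'--> d    *)
Definition is_pushout (a b c d : C) (f : hom c a) (g : hom c b)
    (g' : hom a d) (f' : hom b d) : Prop :=
  g' \oC f = f' \oC g /\
  forall (m : C) (u : hom a m) (v : hom b m), u \oC f = v \oC g ->
    exists! h : hom d m, h \oC g' = u /\ h \oC f' = v.

End Limits.

(* MathComp's [finite_set] would identify the universe of the objects with that
   of the morphisms, which excludes the large category of small sets. *)
Definition finite_type (T : Type) : Prop :=
  exists (n : nat) (f : 'I_n -> T), forall x, exists i, f i = x.

Definition finite_category (J : category) : Prop :=
  finite_type J /\ forall i j : J, finite_type (hom i j).

Definition has_finite_limits (C : category) : Prop :=
  forall (J : category) (D : functor J C), finite_category J ->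
    exists (l : C) (p : forall j : J, hom l (D j)), is_limit p.

Definition has_finite_colimits (C : category) : Prop :=
  has_finite_limits (opposite C).

Record preadditive := Preadditive {
  pa_ob : Type;
  pa_hom : pa_ob -> pa_ob -> zmodType;
  pa_idm : forall a, pa_hom a a;
  pa_comp : forall a b c, pa_hom b c -> pa_hom a b -> pa_hom a c;
  pa_compm1 : forall a b (f : pa_hom a b), pa_comp f (pa_idm a) = f;
  pa_comp1m : forall a b (f : pa_hom a b), pa_comp (pa_idm b) f = f;
  pa_compA : forall a b c d
      (h : pa_hom c d) (g : pa_hom b c) (f : pa_hom a b),
    pa_comp h (pa_comp g f) = pa_comp (pa_comp h g) f;
  pa_compDl : forall a b c (g g' : pa_hom b c) (f : pa_hom a b),
    pa_comp (g + g')%R f = (pa_comp g f + pa_comp g' f)%R;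
  pa_compDr : forall a b c (g : pa_hom b c) (f f' : pa_hom a b),
    pa_comp g (f + f')%R = (pa_comp g f + pa_comp g f')%R
}.

Definition pa_cat (A : preadditive) : category :=
  @Category (pa_ob A) (fun a b => pa_hom a b) (@pa_idm A) (@pa_comp A)
    (@pa_compm1 A) (@pa_comp1m A) (@pa_compA A).
Coercion pa_cat : preadditive >-> category.

Section QuasiAbelian.
Variable A : preadditive.

Definition zero_mor (a b : A) : hom a b := (0 : pa_hom a b)%R.
Definition add_mor (a b : A) (f g : hom a b) : hom a b :=
  ((f : pa_hom a b) + (g : pa_hom a b))%R.

Definition is_biproduct (a b s : A)
    (i : hom a s) (j : hom b s) (p : hom s a) (q : hom s b) : Prop :=
  [/\ p \oC i = idm a, q \oC j = idm b,
      p \oC j = zero_mor b a, q \oC i = zero_mor a b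
    & add_mor (i \oC p) (j \oC q) = idm s].

Definition additive_category : Prop :=
  (exists z : A, initial z /\ terminal z) /\
  (forall a b : A, exists (s : A)
     (i : hom a s) (j : hom b s) (p : hom s a) (q : hom s b),
     is_biproduct i j p q).

Definition is_kernel (k a b : A) (f : hom a b) (i : hom k a) : Prop :=
  f \oC i = zero_mor k b /\
  forall (m : A) (h : hom m a), f \oC h = zero_mor m b ->
    exists! u : hom m k, i \oC u = h.

Definition is_cokernel (a b c : A) (f : hom a b) (p : hom b c) : Prop :=
  p \oC f = zero_mor a c /\
  forall (m : A) (h : hom b m), h \oC f = zero_mor a m ->
    exists! u : hom c m, u \oC p = h.

Definition strict_epi (a b : A) (e : hom a b) : Prop :=
  exists (k : A) (f : hom k a), is_cokernel f e.

Definition strict_mono (a b : A) (i : hom a b) : Prop :=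
  exists (c : A) (f : hom b c), is_kernel f i.

Definition quasi_abelian : Prop :=
  [/\ additive_category, has_finite_limits A, has_finite_colimits A,
      (forall (a b c d : A) (f : hom a c) (g : hom b c)
         (g' : hom d a) (f' : hom d b),
         is_pullback f g g' f' -> strict_epi f -> strict_epi f')
    & (forall (a b c d : A) (f : hom c a) (g : hom c b)
         (g' : hom a d) (f' : hom b d),
         is_pushout f g g' f' -> strict_mono f -> strict_mono f')].

Definition strictly_exact (a b c : A) (f1 : hom a b) (f2 : hom b c) : Prop :=
  f2 \oC f1 = zero_mor a c /\
  exists (k : A) (i : hom k b) (u : hom a k),
    [/\ is_kernel f2 i, i \oC u = f1 & strict_epi u].

Definition projective (P : A) : Prop :=
  forall (a b : A) (e : hom a b), strict_epi e ->
    forall y : hom P b, exists x : hom P a, e \oC x = y.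

Definition enough_projectives : Prop :=
  forall a : A, exists (P : A) (e : hom P a), projective P /\ strict_epi e.

End QuasiAbelian.

Definition strictly_exact_functor (A B : preadditive) (F : functor A B) : Prop :=
  forall (a b c : A) (f1 : hom a b) (f2 : hom b c),
    strictly_exact f1 f2 -> strictly_exact (fmap F f1) (fmap F f2).

(* The object [n : nat] of the simplex category is {0 < ... < n}. *)

Definition monotone m n (f : {ffun 'I_m.+1 -> 'I_n.+1}) : bool :=
  [forall i : 'I_m.+1, forall j : 'I_m.+1, (i <= j)%N ==> (f i <= f j)%N].

Definition Delta_hom (m n : nat) := {f : {ffun 'I_m.+1 -> 'I_n.+1} | monotone f}.

Lemma monotone_id n : monotone [ffun i : 'I_n.+1 => i].
Proof. by apply/'forall_'forall_implyP => i j; rewrite !ffunE. Qed.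

Lemma monotone_comp l m n (g : Delta_hom m n) (f : Delta_hom l m) :
  monotone [ffun i => val g (val f i)].
Proof.
apply/'forall_'forall_implyP => i j ij; rewrite !ffunE.
have /'forall_'forall_implyP gm := valP g.
have /'forall_'forall_implyP fm := valP f.
exact/gm/fm.
Qed.

Lemma monotone_const m n (e : 'I_n.+1) : monotone [ffun _ : 'I_m.+1 => e].
Proof. by apply/'forall_'forall_implyP => i j _; rewrite !ffunE. Qed.

Definition Delta_id n : Delta_hom n n := exist (fun f => monotone f) _ (monotone_id n).
Definition Delta_comp l m n (g : Delta_hom m n) (f : Delta_hom l m) :
  Delta_hom l n := exist (fun f => monotone f) _ (monotone_comp g f).
Definition Delta_const m n (e : 'I_n.+1) : Delta_hom m n :=
  exist (fun f => monotone f) _ (monotone_const m e).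

Definition Delta : category.
Proof.
refine (@Category nat Delta_hom Delta_id Delta_comp _ _ _).
- by move=> a b f; apply/val_inj/ffunP => i; rewrite !ffunE.
- by move=> a b f; apply/val_inj/ffunP => i; rewrite !ffunE.
- by move=> a b c d h g f; apply/val_inj/ffunP => i; rewrite !ffunE.
Defined.

Definition simplicial_object (C : category) := functor (opposite Delta) C.

Record smap (C : category) (X Y : simplicial_object C) := SMap {
  smap_at :> forall n : nat, hom (X n) (Y n);
  smap_nat : forall (m n : nat) (t : Delta_hom m n),
    smap_at m \oC @fmap _ _ X n m t = @fmap _ _ Y n m t \oC smap_at n
}.

Lemma smap_ext (C : category) (X Y : simplicial_object C) (f g : smap X Y) :
  (forall n, f n = g n) -> f = g.
Proof.
case: f g => [f Hf] [g Hg] /= fg.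
have E : f = g by apply: functional_extensionality_dep.
by case: _ / E in Hg *; congr SMap; apply: Prop_irrelevance.
Qed.

Definition smap_id (C : category) (X : simplicial_object C) : smap X X.
Proof.
exists (fun n => idm (X n)).
by move=> m n t; rewrite comp1m compm1.
Defined.

Definition smap_comp (C : category) (X Y Z : simplicial_object C)
  (g : smap Y Z) (f : smap X Y) : smap X Z.
Proof.
exists (fun n => g n \oC f n).
by move=> m n t; rewrite -compA smap_nat compA smap_nat compA.
Defined.

Definition simplicial (C : category) : category.
Proof.
refine (@Category (simplicial_object C) (@smap C) (@smap_id C)
  (@smap_comp C) _ _ _).
- by move=> X Y f; apply: smap_ext => n /=; apply: compm1.
- by move=> X Y f; apply: smap_ext => n /=; apply: comp1m.
- by move=> X Y Z W h g f; apply: smap_ext => n /=; apply: compA.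
Defined.

Definition sfmap (C D : category) (F : functor C D) (X Y : simplicial_object C)
  (f : smap X Y) : smap (fcomp F X) (fcomp F Y).
Proof.
refine (@SMap D (fcomp F X) (fcomp F Y) (fun n => fmap F (f n)) _).
by move=> m n t; rewrite /= -!fmapD smap_nat.
Defined.

Definition sfunctor (C D : category) (F : functor C D) :
  functor (simplicial C) (simplicial D).
Proof.
refine (@Functor (simplicial C) (simplicial D)
  (fun X => fcomp F X) (@sfmap C D F) _ _).
- by move=> X; apply: smap_ext => n /=; apply: fmap1.
- by move=> X Y Z g f; apply: smap_ext => n /=; apply: fmapD.
Defined.

Section SAdjunction.
Variables (C D : category) (L : functor D C) (R : functor C D).
Variable adj : adjunction L R.

Lemma adj_bwd_natl (d' d : D) (c : C) (f : hom d (R c)) (g : hom d' d) :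
  adj_bwd adj (f \oC g) = adj_bwd adj f \oC fmap L g.
Proof. by rewrite -{1}[f](adj_bwdK adj) -adj_natl adj_fwdK. Qed.

Lemma adj_bwd_natr (d : D) (c c' : C) (h : hom c c') (f : hom d (R c)) :
  adj_bwd adj (fmap R h \oC f) = h \oC adj_bwd adj f.
Proof. by rewrite -{1}[f](adj_bwdK adj) -adj_natr adj_fwdK. Qed.

Definition sadj_fwd (X : simplicial_object D) (Y : simplicial_object C)
  (f : smap (fcomp L X) Y) : smap X (fcomp R Y).
Proof.
refine (@SMap D X (fcomp R Y)
  (fun n => @adj_fwd _ _ _ _ adj (X n) (Y n) (f n)) _).
by move=> m n t; rewrite /= -adj_natl (smap_nat f t) adj_natr.
Defined.

Definition sadj_bwd (X : simplicial_object D) (Y : simplicial_object C)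
  (f : smap X (fcomp R Y)) : smap (fcomp L X) Y.
Proof.
refine (@SMap C (fcomp L X) Y
  (fun n => @adj_bwd _ _ _ _ adj (X n) (Y n) (f n)) _).
by move=> m n t; rewrite /= -adj_bwd_natl (smap_nat f t) adj_bwd_natr.
Defined.

Definition sadjunction : adjunction (sfunctor L) (sfunctor R).
Proof.
refine (@Adjunction _ _ (sfunctor L) (sfunctor R) sadj_fwd sadj_bwd _ _ _ _).
- by move=> X Y f; apply: smap_ext => n /=; apply: adj_fwdK.
- by move=> X Y f; apply: smap_ext => n /=; apply: adj_bwdK.
- by move=> X' X Y f g; apply: smap_ext => n /=; apply: adj_natl.
- by move=> X Y Y' h f; apply: smap_ext => n /=; apply: adj_natr.
Defined.

End SAdjunction.

Definition TypeCat : category :=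
  @Category Type (fun a b => a -> b) (fun a x => x)
    (fun a b c g f x => g (f x))
    (fun a b f => erefl) (fun a b f => erefl) (fun a b c d h g f => erefl).

Definition sSet : category := simplicial TypeCat.

Definition hom_functor (C : category) (P : C) : functor C TypeCat.
Proof.
refine (@Functor C TypeCat (fun a => hom P a) (fun a b f x => f \oC x) _ _).
- by move=> a; apply: funext => x; apply: comp1m.
- by move=> a b c g f; apply: funext => x; rewrite /= compA.
Defined.

Definition simplex (n : nat) : sSet := @hom_functor (opposite Delta) n.

(* An m-simplex of the simplex Δ[n], i.e. a monotone map [m] -> [n], lies in the
   k-th horn iff its image misses some vertex other than k. *)
Definition in_horn (n : nat) (k : 'I_n.+1) (m : nat) (s : Delta_hom m n) : bool :=
  [exists j : 'I_n.+1, (j != k) && [forall i, val s i != j]].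

Lemma in_horn_comp n (k : 'I_n.+1) l m (s : Delta_hom m n) (t : Delta_hom l m) :
  in_horn k s -> in_horn k (Delta_comp s t).
Proof.
case/existsP=> j /andP[jk /forallP sj]; apply/existsP; exists j.
by rewrite jk; apply/forallP => i; rewrite ffunE.
Qed.

Definition horn (n : nat) (k : 'I_n.+1) : sSet.
Proof.
refine (@Functor (opposite Delta) TypeCat
  (fun m => {s : Delta_hom m n | in_horn k s})
  (fun m l t s => exist _ (Delta_comp (val s) t) (in_horn_comp t (valP s)))
  _ _).
- by move=> m; apply: funext => s; apply: val_inj; apply: (@compm1 Delta).
- move=> a b c g f; apply: funext => s; apply: val_inj.
  exact: (@compA Delta).
Defined.

Definition horn_incl (n : nat) (k : 'I_n.+1) : hom (horn k) (simplex n) :=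
  @SMap TypeCat (horn k) (simplex n) (fun m s => val s)
    (fun l m t => erefl).

Definition has_lift (C : category) (a b x y : C)
    (i : hom a b) (p : hom x y) : Prop :=
  forall (u : hom a x) (v : hom b y), p \oC u = v \oC i ->
    exists h : hom b x, h \oC i = u /\ p \oC h = v.

Definition kan_fibration (X Y : sSet) (p : hom X Y) : Prop :=
  forall (n : nat) (k : 'I_n.+2), has_lift (horn_incl k) p.

Definition kan_complex (Z : sSet) : Prop :=
  forall (n : nat) (k : 'I_n.+2) (u : hom (horn k) Z),
    exists h : hom (simplex n.+1) Z, h \oC horn_incl k = u.

Definition cylinder (X : sSet) : sSet.
Proof.
refine (@Functor (opposite Delta) TypeCat
  (fun n => ((X : simplicial_object _) n * Delta_hom n 1)%type)
  (fun n m t xs =>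
     (@fmap _ _ (X : simplicial_object _) n m t xs.1, Delta_comp xs.2 t)) _ _).
- move=> n; apply: funext => -[x s] /=; rewrite fmap1; congr pair.
  exact: (@compm1 Delta).
- move=> a b c g f; apply: funext => -[x s] /=; rewrite fmapD; congr pair.
  exact: (@compA Delta).
Defined.

Definition cylinder_end (e : 'I_2) (X : sSet) : hom X (cylinder X).
Proof.
refine (@SMap TypeCat X (cylinder X) (fun n x => (x, Delta_const n e)) _).
move=> m n t; apply: funext => x /=; congr pair.
by apply/val_inj/ffunP => i; rewrite !ffunE.
Defined.

Definition homotopy_step (X Z : sSet) (f g : hom X Z) : Prop :=
  exists H : hom (cylinder X) Z,
    H \oC cylinder_end ord0 X = f /\ H \oC cylinder_end ord_max X = g.

(* Equality in π₀ of the mapping space Map(X, Z), whose edges are the maps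
   X × Δ[1] -> Z. *)
Definition homotopic (X Z : sSet) : hom X Z -> hom X Z -> Prop :=
  clos_refl_sym_trans (hom X Z) (@homotopy_step X Z).

(* The weak homotopy equivalences, in the combinatorial form of the definition:
   f is one iff π₀ Map(Y, Z) -> π₀ Map(X, Z) is bijective for
   every Kan complex Z; the two conjuncts are surjectivity and injectivity. *)
Definition sset_weak_equivalence (X Y : sSet) (f : hom X Y) : Prop :=
  forall Z : sSet, kan_complex Z ->
    (forall g : hom X Z, exists h : hom Y Z, homotopic (h \oC f) g) /\
    (forall h h' : hom Y Z,
       homotopic (h \oC f) (h' \oC f) -> homotopic h h').

Definition retract_of (C : category) (a b x y : C)
    (f : hom a b) (g : hom x y) : Prop :=
  exists (i : hom a x) (r : hom x a) (j : hom b y) (s : hom y b),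
    [/\ r \oC i = idm a, s \oC j = idm b, g \oC i = j \oC f
      & f \oC r = s \oC g].

Definition retract_closed (C : category)
    (W : forall a b : C, hom a b -> Prop) : Prop :=
  forall (a b x y : C) (f : hom a b) (g : hom x y),
    retract_of f g -> W x y g -> W a b f.

(* Quillen's closed model categories: only finite limits and colimits, and no
   functoriality of the factorizations. *)
Record model_structure (C : category) := ModelStructure {
  weq : forall a b : C, hom a b -> Prop;
  fib : forall a b : C, hom a b -> Prop;
  cof : forall a b : C, hom a b -> Prop;
  ms_lim : has_finite_limits C;
  ms_colim : has_finite_colimits C;
  ms_weq_comp : forall (a b c : C) (g : hom b c) (f : hom a b),
    weq f -> weq g -> weq (g \oC f);
  ms_weq_cancell : forall (a b c : C) (g : hom b c) (f : hom a b),
    weq g -> weq (g \oC f) -> weq f;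
  ms_weq_cancelr : forall (a b c : C) (g : hom b c) (f : hom a b),
    weq f -> weq (g \oC f) -> weq g;
  ms_weq_retract : retract_closed weq;
  ms_fib_retract : retract_closed fib;
  ms_cof_retract : retract_closed cof;
  ms_lift_tfib : forall (a b x y : C) (i : hom a b) (p : hom x y),
    cof i -> fib p -> weq p -> has_lift i p;
  ms_lift_tcof : forall (a b x y : C) (i : hom a b) (p : hom x y),
    cof i -> weq i -> fib p -> has_lift i p;
  ms_fact_tfib : forall (a b : C) (f : hom a b),
    exists (c : C) (i : hom a c) (p : hom c b),
      [/\ cof i, fib p, weq p & p \oC i = f];
  ms_fact_tcof : forall (a b : C) (f : hom a b),
    exists (c : C) (i : hom a c) (p : hom c b),
      [/\ cof i, weq i, fib p & p \oC i = f]
}.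
Arguments weq {C} _ {a b} _.
Arguments fib {C} _ {a b} _.
Arguments cof {C} _ {a b} _.

Definition cofibrant (C : category) (M : model_structure C) (x : C) : Prop :=
  forall (z : C) (i : hom z x), initial z -> cof M i.

Definition fibrant (C : category) (M : model_structure C) (x : C) : Prop :=
  forall (z : C) (p : hom x z), terminal z -> fib M p.

Section Quillen.
Variables (C D : category) (MC : model_structure C) (MD : model_structure D).
Variables (L : functor D C) (R : functor C D) (adj : adjunction L R).

Definition quillen_adjunction : Prop :=
  forall (x y : D) (i : hom x y), cof MD i ->
    cof MC (fmap L i) /\ (weq MD i -> weq MC (fmap L i)).

Definition quillen_equivalence : Prop :=
  quillen_adjunction /\
  forall (x : D) (y : C) (f : hom (L x) y), cofibrant MD x -> fibrant MC y ->
    (weq MC f <-> weq MD (adj_fwd adj f)).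

End Quillen.

(* The weak equivalences and the fibrations determine the cofibrations, so that
   this describes at most one model structure on simplicial objects. *)
Record projective_model_structure (Q : preadditive) := ProjectiveModelStructure {
  pms_model :> model_structure (simplicial Q);
  pms_weq : forall (X Y : simplicial Q) (f : hom X Y),
    weq pms_model f <->
    forall P : Q, projective P ->
      sset_weak_equivalence (fmap (sfunctor (@hom_functor Q P)) f);
  pms_fib : forall (X Y : simplicial Q) (f : hom X Y),
    fib pms_model f <->
    forall P : Q, projective P ->
      kan_fibration (fmap (sfunctor (@hom_functor Q P)) f)
}.

(* Main.v *)
(* A projective [P'] of [Q'] is a retract of some [F q], and the unit of the
   adjunction is invertible at [F q] because [F] is fully faithful; hence it is
   invertible at [P'].  A cofibrant simplicial object of [Q'] is projective in
   each degree, so its unit is an isomorphism.  It remains to see that [F]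
   preserves and reflects weak equivalences: the projectives of [Q] are the
   retracts of the objects [F' P'] with [P'] projective, and
   [hom (F' P') X = hom P' (F X)].

   Degreewise projectivity of a cofibrant object [X] comes from the right
   adjoint of evaluation in degree [n]: it turns a strict epimorphism into a
   trivial fibration. *)
From mathcomp Require Import all_boot all_algebra.
From mathcomp Require Import boolp.
From Stdlib Require Import Relations.
Require Import Defs.

Set Implicit Arguments.
Unset Strict Implicit.
Unset Printing Implicit Defensive.

Import GRing.Theory.

(** * Initial and terminal objects, and isomorphisms of simplicial objects *)

Lemma initial_eq (C : category) (a z : C) (f g : hom z a) :
  initial z -> f = g.
Proof. by move=> /(_ a)[h [_ hU]]; rewrite -(hU f) // -(hU g). Qed.

Lemma terminal_eq (C : category) (a z : C) (f g : hom a z) :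
  terminal z -> f = g.
Proof. by move=> /(_ a)[h [_ hU]]; rewrite -(hU f) // -(hU g). Qed.

Lemma smap_iso (C : category) (X Y : simplicial C) (f : hom X Y) :
  (forall n, exists g, g \oC (f : smap X Y) n = idm ((X : simplicial_object C) n) /\
                       (f : smap X Y) n \oC g = idm ((Y : simplicial_object C) n)) ->
  exists g : hom Y X, g \oC f = idm X /\ f \oC g = idm Y.
Proof.
move=> fiso; pose g n := sval (cid (fiso n)).
have gf n : g n \oC (f : smap X Y) n = idm _ := (svalP (cid (fiso n))).1.
have fg n : (f : smap X Y) n \oC g n = idm _ := (svalP (cid (fiso n))).2.
have gnat m n (t : Delta_hom m n) :
    g m \oC @fmap _ _ Y n m t = @fmap _ _ X n m t \oC g n.
  rewrite -[LHS]compm1 -(fg n) -compA (compA _ _ (g n)).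
  by rewrite -(smap_nat (f : smap X Y) t) !compA gf comp1m.
by exists (SMap gnat); split; apply: smap_ext.
Qed.

(** * Weak equivalences and fibrations of simplicial sets *)

Definition cylinder_map (X Y : sSet) (k : hom X Y) :
  hom (cylinder X) (cylinder Y).
Proof.
refine (@SMap TypeCat (cylinder X) (cylinder Y)
  (fun n xs => ((k : smap X Y) n xs.1, xs.2)) _).
move=> m n t; apply: funext => -[x s] /=; congr pair.
exact: (congr1 (fun f => f x) (smap_nat (k : smap X Y) t)).
Defined.

Lemma homotopic_precomp (X Y Z : sSet) (f g : hom Y Z) (k : hom X Y) :
  homotopic f g -> homotopic (f \oC k) (g \oC k).
Proof.
elim=> [f' g' [H [H0 H1]]|f'|f' g' _ IH|f' g' h' _ IH1 _ IH2].
- apply: rst_step; exists (H \oC cylinder_map k).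
  by split; [rewrite -H0|rewrite -H1]; apply: smap_ext.
- exact: rst_refl.
- exact: rst_sym.
- exact: rst_trans IH1 IH2.
Qed.

Lemma homotopic_postcomp (X Y Z : sSet) (f g : hom X Y) (k : hom Y Z) :
  homotopic f g -> homotopic (k \oC f) (k \oC g).
Proof.
elim=> [f' g' [H [H0 H1]]|f'|f' g' _ IH|f' g' h' _ IH1 _ IH2].
- apply: rst_step; exists (k \oC H).
  by split; [rewrite -H0|rewrite -H1]; rewrite compA.
- exact: rst_refl.
- exact: rst_sym.
- exact: rst_trans IH1 IH2.
Qed.

(** Homotopy classes of maps into [Z] are functorial in the source, so a retract of maps becomes a
    retract of functions between sets, and bijections are closed under retracts. *)
Lemma sset_weq_retract : retract_closed sset_weak_equivalence.
Proof.
move=> a b x y f g [i [r [j [s [ri sj gi fr]]]]] gW Z KZ.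
have [surj inj] := gW Z KZ; split.
- move=> u; have [h hg] := surj (u \oC r); exists (h \oC j).
  have := homotopic_precomp i hg.
  by rewrite -!compA ri compm1 gi.
- move=> h h' /(homotopic_precomp r); rewrite -!compA fr !compA => /inj.
  by move=> /(homotopic_precomp j); rewrite -!compA sj !compm1.
Qed.

Lemma has_lift_retract (C : category) (a b x y x' y' : C) (i : hom a b)
    (f : hom x y) (g : hom x' y') :
  retract_of f g -> has_lift i g -> has_lift i f.
Proof.
move=> [k [r [j [s [rk sj gk fr]]]]] lg u v fu.
have [|h [hi gh]] := lg (k \oC u) (j \oC v).
  by rewrite compA gk -compA fu compA.
exists (r \oC h); split.
  by rewrite -compA hi compA rk comp1m.
by rewrite compA fr -compA gh compA sj comp1m.
Qed.

Lemma kan_fibration_retract : retract_closed kan_fibration.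
Proof. by move=> a b x y f g fg gK n k; apply: has_lift_retract (gK n k). Qed.

(** Any [g] is a homotopy inverse of [f]: both composites are homotopic to identities. *)
Lemma sset_weq_contractible (X Y : sSet) (f : hom X Y) (g : hom Y X) :
  (forall h h' : hom X X, homotopic h h') ->
  (forall h h' : hom Y Y, homotopic h h') ->
  sset_weak_equivalence f.
Proof.
move=> cX cY Z _; split=> [h|h h' hh].
  exists (h \oC g); rewrite -compA -[X in homotopic _ X]compm1.
  exact/homotopic_postcomp/cX.
have hE (k : hom Y Z) : homotopic k ((k \oC f) \oC g).
  rewrite -compA -[X in homotopic X]compm1.
  exact/homotopic_postcomp/cY.
have hgf : homotopic ((h \oC f) \oC g) ((h' \oC f) \oC g).
  exact: homotopic_precomp.
have hE' := rst_sym _ _ _ _ (hE h').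
exact: (rst_trans _ _ _ _ _ (hE h) (rst_trans _ _ _ _ _ hgf hE')).
Qed.

(** * Objects coinduced from degree [n] *)

(* [X m] is the power of [a] indexed by the maps from [n] to [m]: [X] is the
   value at [a] of the right adjoint of evaluation in degree [n]. *)
Definition coinduced (C : category) (n : nat) (X : simplicial_object C) (a : C)
    (ev : hom (X n) a) : Prop :=
  forall (m : nat) (c : C) (f : Delta_hom n m -> hom c a),
    exists! g : hom c (X m),
      forall t, ev \oC @fmap _ _ X m n t \oC g = f t.

Section Coinduced.
Variables (C : category) (n : nat) (X : simplicial_object C) (a : C).
Variables (ev : hom (X n) a) (coX : coinduced ev).

Lemma coinduced_inj m (c : C) (g g' : hom c (X m)) :
  (forall t : Delta_hom n m,
    ev \oC @fmap _ _ X m n t \oC g = ev \oC @fmap _ _ X m n t \oC g') -> g = g'.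
Proof.
move=> gg'.
have [k [_ kU]] := coX (fun t => ev \oC @fmap _ _ X m n t \oC g').
by rewrite -(kU g) // -(kU g').
Qed.

(** With [coinduced_map_inj] this is the adjunction bijection between maps [K -> X] and maps
    [K n -> a]. *)
Lemma coinduced_map (K : simplicial_object C) (f : hom (K n) a) :
  exists k : smap K X, ev \oC k n = f.
Proof.
pose k m := sval (cid (coX (fun t => f \oC @fmap _ _ K m n t))).
have kP m (t : Delta_hom n m) :
    ev \oC @fmap _ _ X m n t \oC k m = f \oC @fmap _ _ K m n t.
  exact: (svalP (cid (coX (fun t => f \oC @fmap _ _ K m n t)))).1.
have knat m l (t : Delta_hom m l) :
    k m \oC @fmap _ _ K l m t = @fmap _ _ X l m t \oC k l.
  apply: coinduced_inj => s; rewrite !compA kP.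
  rewrite -!compA [X in ev \oC X]compA.
  rewrite -(@fmapD _ _ K l m n s t) -(@fmapD _ _ X l m n s t).
  by rewrite compA kP.
exists (SMap knat) => /=.
have := kP n (Delta_id n).
by rewrite (@fmap1 _ _ X n) (@fmap1 _ _ K n) !compm1.
Qed.

Lemma coinduced_map_inj (K : simplicial_object C) (k k' : smap K X) :
  ev \oC k n = ev \oC k' n -> k = k'.
Proof.
move=> kk'; apply: smap_ext => m; apply: coinduced_inj => t.
by rewrite -!compA -!smap_nat !compA kk'.
Qed.

End Coinduced.

(** The functor [hom P] preserves powers; the factorization is built pointwise in [c]. *)
Lemma coinduced_hom (C : category) (P : C) n (X : simplicial_object C) (a : C)
    (ev : hom (X n) a) :
  coinduced ev ->
  @coinduced TypeCat n (fcomp (hom_functor P) X) (hom P a)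
    (fmap (hom_functor P) ev).
Proof.
move=> coX m c f.
have /choice[g gP] : forall x : c, exists g : hom P (X m),
    forall t, ev \oC @fmap _ _ X m n t \oC g = f t x.
  by move=> x; have [g [gP _]] := coX m P (f^~ x); exists g.
exists g; split=> [t|g' g'P].
  by apply: funext => x /=; rewrite compA gP.
apply: funext => x; apply: (coinduced_inj coX) => t.
by rewrite gP -g'P /= compA.
Qed.

Section CoinducedSimplicialSets.
Variable n : nat.

(** By transposition a homotopy is any function on degree [n] of the cylinder, with no naturality to
    check: take [f] over the constant map 0 and [g] elsewhere. *)
Lemma coinduced_homotopic (X : sSet) (A : TypeCat)
    (ev : hom ((X : simplicial_object _) n) A) (K : sSet) (f g : hom K X) :
  @coinduced TypeCat n X A ev -> homotopic f g.
Proof.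
move=> coX; apply: rst_step.
have [H HP] := @coinduced_map TypeCat n X A ev coX (cylinder K)
  (fun xs => ev (if xs.2 == Delta_const n ord0 then (f : smap K X) n xs.1
                 else (g : smap K X) n xs.1)).
exists H; split; apply: (@coinduced_map_inj TypeCat n X A ev coX K);
  apply: funext => x;
  rewrite [LHS](congr1 (fun h => h (x, Delta_const n _)) HP) /= ?eqxx //.
case: eqP => // /(congr1 (fun s : Delta_hom n 1 => val s ord0)).
by rewrite !ffunE.
Qed.

(* Transposing to degree [n], this is the lifting of an injection of sets
   against a surjection. *)
Lemma coinduced_lift (X Y : sSet) (A B : TypeCat)
    (evX : hom ((X : simplicial_object _) n) A)
    (evY : hom ((Y : simplicial_object _) n) B)
    (p : hom X Y) (e : A -> B) (K L : sSet) (i : hom K L) :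
  @coinduced TypeCat n X A evX -> @coinduced TypeCat n Y B evY ->
  (forall x, evY ((p : smap X Y) n x) = e (evX x)) ->
  (forall y, exists x, e x = y) -> injective ((i : smap K L) n) ->
  has_lift i p.
Proof.
move=> coX coY pe esurj iinj u v puvi.
have [h hP] : exists h : hom ((L : simplicial_object _) n) A,
    (forall x, h ((i : smap K L) n x) = evX ((u : smap K X) n x)) /\
    (forall y, e (h y) = evY ((v : smap L Y) n y)).
  have /choice[h hP] : forall y : (L : simplicial_object _) n, exists z : A,
      (forall x, (i : smap K L) n x = y -> z = evX ((u : smap K X) n x)) /\
      e z = evY ((v : smap L Y) n y).
    move=> y; have [[x xy]|nx] := pselect (exists x, (i : smap K L) n x = y).
      exists (evX ((u : smap K X) n x)); split=> [x' x'y|].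
        by congr (evX _); congr ((u : smap K X) n _); apply: iinj; rewrite xy.
      rewrite -pe -xy.
      by have /(congr1 (fun q : smap K Y => evY (q n x))) := puvi.
    have [z zP] := esurj (evY ((v : smap L Y) n y)).
    by exists z; split=> // x xy; case: nx; exists x.
  by exists h; split=> [x|y]; [apply: (hP _).1|apply: (hP _).2].
have [k kP] := @coinduced_map TypeCat n X A evX coX L h.
exists k; split.
  apply: (@coinduced_map_inj TypeCat n X A evX coX K); apply: funext => x /=.
  by rewrite -hP.1 -kP.
apply: (@coinduced_map_inj TypeCat n Y B evY coY L); apply: funext => y /=.
by rewrite pe -hP.2 -kP.
Qed.

End CoinducedSimplicialSets.

(** * Finite powers and the existence of coinduced objects *)

Definition discrete (T : Type) : category.
Proof.
by refine (@Category T (fun i j => i = j) (fun i => erefl)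
  (fun i j k jk ij => etrans ij jk) _ _ _) => *; apply: Prop_irrelevance.
Defined.

Definition discrete_const (T : Type) (C : category) (a : C) :
  functor (discrete T) C.
Proof.
refine (@Functor (discrete T) C (fun=> a) (fun _ _ _ => idm a) _ _) => //.
by move=> *; rewrite comp1m.
Defined.

Lemma finite_power (C : category) (T : finType) (a : C) :
  has_finite_limits C ->
  exists (l : C) (p : T -> hom l a),
    forall (c : C) (f : T -> hom c a), exists! g : hom c l,
      forall t, p t \oC g = f t.
Proof.
move=> limC.
have [|l [p [_ pU]]] := limC (discrete T) (discrete_const T a).
  split=> [|i j].
    by exists #|T|, enum_val => x; exists (enum_rank x); apply: enum_rankK.
  (* Each hom-type of the discrete category has exactly one element or none. *)
  have [ij|nij] := pselect (i = j).
    by exists 1%N, (fun=> ij) => x; exists ord0; exact: (@Prop_irrelevance (i = j)).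
  exists 0%N.
  have f0 (k : 'I_0) : i = j by case: k.
  by exists f0 => x; case: nij; exact: x.
exists l, p => c f; apply: (pU c f) => i j u /=.
by case: _ / u; rewrite comp1m.
Qed.

(** Degree [m] is the power of [a] by the finite set [Delta_hom n m], simplicial by composition on
    the indices; [ev] is the projection at the identity. *)
Lemma coinduced_exists (C : category) (n : nat) (a : C) :
  has_finite_limits C ->
  exists (X : simplicial_object C) (ev : hom (X n) a), coinduced ev.
Proof.
move=> limC.
have /choice[L] : forall m, exists l : C, exists p : Delta_hom n m -> hom l a,
    forall (c : C) (f : Delta_hom n m -> hom c a), exists! g : hom c l,
      forall t, p t \oC g = f t.
  by move=> m; apply: finite_power.
move=> /(fun H m => cid (H m)) H.
pose p m := sval (H m).
have pU m : forall (c : C) (f : Delta_hom n m -> hom c a),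
    exists! g : hom c (L m), forall t, p m t \oC g = f t := svalP (H m).
have p_inj m (c : C) (g g' : hom c (L m)) :
    (forall t, p m t \oC g = p m t \oC g') -> g = g'.
  move=> gg'; have [k [_ kU]] := pU m c (fun t => p m t \oC g').
  by rewrite -(kU g) // -(kU g').
pose LmapP l m (t : Delta_hom l m) := cid (pU l (L m) (fun s => p m (Delta_comp t s))).
pose Lmap l m (t : Delta_hom l m) : hom (L m) (L l) := sval (LmapP l m t).
have LmapE l m (t : Delta_hom l m) s :
    p l s \oC Lmap l m t = p m (Delta_comp t s) := (svalP (LmapP l m t)).1 s.
have Lmap1 m : Lmap m m (Delta_id m) = idm (L m).
  by apply: p_inj => s; rewrite LmapE compm1; congr p; apply: (@comp1m Delta).
have LmapD l m k (t : Delta_hom l m) (u : Delta_hom m k) :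
    Lmap l k (Delta_comp u t) = Lmap l m t \oC Lmap m k u.
  apply: p_inj => s; rewrite compA !LmapE; congr p.
  exact: esym (@compA Delta _ _ _ _ _ _ _).
pose X : simplicial_object C := @Functor (opposite Delta) C L
  (fun m l t => Lmap l m t) Lmap1 (fun _ _ _ t u => LmapD _ _ _ t u).
exists X, (p n (Delta_id n)) => m c f.
have [g [gP gU]] := pU m c f.
have evE t : p n (Delta_id n) \oC @fmap _ _ X m n t = p m t.
  by rewrite /= LmapE; congr p; apply: (@compm1 Delta).
exists g; split=> [t|g' g'P]; first by rewrite evE.
by apply: gU => t; rewrite -evE.
Qed.

(** * Zero morphisms and strict epimorphisms *)

Section ZeroMorphisms.
Variable A : preadditive.

Lemma zero_mor_compr (a b c : A) (f : hom a b) :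
  zero_mor b c \oC f = zero_mor a c.
Proof.
have := pa_compDl (0%R : pa_hom b c) 0%R (f : pa_hom a b).
by rewrite addr0 -[LHS]addr0 => /addrI.
Qed.

Lemma zero_mor_compl (a b c : A) (f : hom b c) :
  f \oC zero_mor a b = zero_mor a c.
Proof.
have := pa_compDr (f : pa_hom b c) (0%R : pa_hom a b) 0%R.
by rewrite addr0 -[LHS]addr0 => /addrI.
Qed.

Lemma strict_epi_cancel (a b c : A) (e : hom a b) (f g : hom b c) :
  strict_epi e -> f \oC e = g \oC e -> f = g.
Proof.
move=> [k [h [eh0 eU]]] fg.
have [|w [_ wU]] := eU c (g \oC e).
  by rewrite -compA eh0 zero_mor_compl.
by rewrite -(wU f) // -(wU g).
Qed.

Lemma strict_epi_split (P a : A) (e : hom a P) :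
  projective P -> strict_epi e -> exists s, e \oC s = idm P.
Proof. by move=> PP eS; apply: PP. Qed.

(** Turns a strict epimorphism into a strictly exact sequence, to which a strictly exact functor
    applies. *)
Lemma strictly_exact_to_zero (a b z : A) (e : hom a b) :
  terminal z -> strict_epi e -> strictly_exact e (zero_mor b z).
Proof.
move=> zT eS; split; first exact: terminal_eq.
exists b, (idm b), e; split=> //; last exact: comp1m.
split.
  exact: terminal_eq.
move=> m h _; exists h; split; first exact: comp1m.
by move=> u <-; rewrite comp1m.
Qed.

End ZeroMorphisms.

(** * Model categories *)

Section ModelStructure.
Variables (C : category) (M : model_structure C).

(** An isomorphism is a retract of the trivial fibration in any of its factorizations. *)
Lemma weq_iso (a b : C) (f : hom a b) (g : hom b a) :
  g \oC f = idm a -> f \oC g = idm b -> weq M f.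
Proof.
move=> gf fg; have [c [i [p [_ _ pW pi]]]] := ms_fact_tfib M f.
apply: ms_weq_retract pW.
exists i, (g \oC p), (idm b), (idm b); split.
- by rewrite -compA pi.
- exact: comp1m.
- by rewrite comp1m.
- by rewrite compA fg.
Qed.

(** The retract argument: the lift in the square with sides [i] and the identity is a section of
    [p]. *)
Lemma retract_of_has_lift (a b c : C) (i : hom a c) (p : hom c b) :
  has_lift (p \oC i) p -> retract_of (p \oC i) i.
Proof.
move=> /(_ i (idm b)); rewrite comp1m => /(_ erefl)[h [hi ph]].
exists (idm a), (idm a), h, p; split=> //.
- exact: comp1m.
- by rewrite compm1.
- by rewrite compm1.
Qed.

End ModelStructure.

(** * Adjunctions: lifting properties, Quillen pairs and units *)

Lemma has_lift_adj (C D : category) (L : functor D C) (R : functor C D)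
    (adj : adjunction L R) (a b : D) (x y : C) (i : hom a b) (p : hom x y) :
  has_lift i (fmap R p) -> has_lift (fmap L i) p.
Proof.
move=> lp u v pu.
have [|h [hi ph]] := lp (adj_fwd adj u) (adj_fwd adj v).
  by rewrite -adj_natr pu adj_natl.
exists (adj_bwd adj h).
by rewrite -adj_bwd_natl hi adj_fwdK -adj_bwd_natr ph adj_fwdK.
Qed.

(** Factor [L i] as [p \oC j]. By transposition [L i] lifts against [p], so the retract argument
    makes it a retract of [j]. *)
Lemma quillen_adjunction_right (C D : category) (MC : model_structure C)
    (MD : model_structure D) (L : functor D C) (R : functor C D)
    (adj : adjunction L R) :
  (forall (x y : C) (p : hom x y), fib MC p -> fib MD (fmap R p)) ->
  (forall (x y : C) (p : hom x y), weq MC p -> weq MD (fmap R p)) ->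
  quillen_adjunction MC MD L.
Proof.
move=> Rfib Rweq x y i iC; split=> [|iW].
  have [c [j [p [jC pF pW pj]]]] := ms_fact_tfib MC (fmap L i).
  apply: ms_cof_retract jC; rewrite -pj; apply: retract_of_has_lift.
  rewrite pj; apply: (has_lift_adj adj).
  by apply: ms_lift_tfib iC _ _; [apply: Rfib|apply: Rweq].
have [c [j [p [jC jW pF pj]]]] := ms_fact_tcof MC (fmap L i).
apply: ms_weq_retract jW; rewrite -pj; apply: retract_of_has_lift.
rewrite pj; apply: (has_lift_adj adj).
by apply: ms_lift_tcof iC iW _; apply: Rfib.
Qed.

(** Fullness writes the unit at [R c] as the image of a map of [C]; the equation can then be checked
    in [C], where both sides have the unit as transpose. *)
Lemma fully_faithful_unit (C D : category) (L : functor D C) (R : functor C D)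
    (adj : adjunction L R) (c : C) :
  fully_faithful R ->
  adj_fwd adj (idm (L (R c))) \oC fmap R (adj_bwd adj (idm (R c))) =
    idm (R (L (R c))).
Proof.
move=> ffR; have [g _ Rg] := ffR c (L (R c)).
set e := adj_bwd adj (idm (R c)); set u := adj_fwd adj _.
rewrite -(Rg u) -fmapD -fmap1; congr fmap.
apply: (can_inj (@adj_fwdK _ _ _ _ adj _ _)).
by rewrite adj_natr Rg /e adj_bwdK compm1.
Qed.

Lemma unit_retract_iso (C D : category) (L : functor D C) (R : functor C D)
    (adj : adjunction L R) (d : D) (c : C) (e : hom (R c) d) (s : hom d (R c)) :
  fully_faithful R -> e \oC s = idm d ->
  exists r, r \oC adj_fwd adj (idm (L d)) = idm d /\
            adj_fwd adj (idm (L d)) \oC r = idm (R (L d)).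
Proof.
move=> ffR es.
have unit_nat (d1 d2 : D) (f : hom d1 d2) :
    adj_fwd adj (idm (L d2)) \oC f =
    fmap R (fmap L f) \oC adj_fwd adj (idm (L d1)).
  by rewrite -adj_natr -adj_natl comp1m compm1.
set eps := adj_bwd adj (idm (R c)).
(* The inverse [fmap R eps] of the unit at [R c], carried to [d] along the retraction. *)
exists (e \oC (fmap R eps \oC fmap R (fmap L s))); split.
  rewrite -!compA -unit_nat (compA (fmap R eps)) -adj_natr compm1.
  by rewrite /eps adj_bwdK comp1m.
rewrite compA unit_nat -compA (compA _ (fmap R eps)) fully_faithful_unit //.
by rewrite comp1m -fmapD -fmapD es !fmap1.
Qed.

(** * The projective model structure *)

(** After applying [hom P] both objects are coinduced from sets, [e] becomes a surjection, and horn
    inclusions are injective in each degree. *)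
Lemma projective_hom_trivial_fibration (A : preadditive) (P a b : A)
    (e : hom a b) (n : nat) (X Y : simplicial A) (evX : hom (X n) a) (evY : hom (Y n) b)
    (p : smap X Y) :
  projective P -> strict_epi e -> coinduced evX -> coinduced evY ->
  evY \oC p n = e \oC evX ->
  let pP := fmap (sfunctor (hom_functor P)) (p : hom X Y) in
  kan_fibration pP /\ sset_weak_equivalence pP.
Proof.
move=> PP eS /(coinduced_hom (P := P)) coX /(coinduced_hom (P := P)) coY pe /=; split.
  move=> m k.
  apply: (coinduced_lift (e := fun x : hom P a => e \oC x) coX coY).
  - move=> x.
    by rewrite -[LHS]/(evY \oC (p n \oC x)) compA pe -compA.
  - exact: PP.
  - by move=> /= ? ?; apply: val_inj.
(* Some map backwards is required; a zero morphism supplies the value to transpose. *)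
have [g _] := @coinduced_map TypeCat n _ _ _ coX
  (fcomp (hom_functor P) Y) (fun=> zero_mor P a).
refine (@sset_weq_contractible (fcomp (hom_functor P) X) (fcomp (hom_functor P) Y) _ g _ _) => h h'.
- exact: coinduced_homotopic coX.
- exact: coinduced_homotopic coY.
Qed.

(** * Cofibrant simplicial objects *)

Definition constant (C : category) (z : C) : simplicial_object C.
Proof.
by refine (@Functor (opposite Delta) C (fun=> z) (fun _ _ _ => idm z) _ _);
  move=> *; rewrite ?comp1m.
Defined.

Lemma constant_initial (C : category) (z : C) :
  initial z -> @initial (simplicial C) (constant z).
Proof.
move=> zI X.
have fP n : {f : hom z (X n) | True} by apply: cid; case: (zI (X n)) => f _; exists f.
have fnat m n (t : Delta_hom m n) :
    sval (fP m) \oC @fmap _ _ (constant z) n m t = @fmap _ _ X n m t \oC sval (fP n).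
  exact: initial_eq.
exists (SMap fnat : smap (constant z) X); split=> // g _.
by apply: smap_ext => n; apply: initial_eq.
Qed.

Lemma cofibrant_projective (A : preadditive) (M : projective_model_structure A)
    (X : simplicial A) (n : nat) :
  quasi_abelian A -> cofibrant M X -> @projective A (X n).
Proof.
move=> [[[z [zI zT]] _] limA _ _ _] XC a b e eS y.
have [Ra [eva coa]] := coinduced_exists n a limA.
have [Rb [evb cob]] := coinduced_exists n b limA.
(* Coinduce [e] to a trivial fibration [p], and transpose [y] to a map [y'] into its target. *)
have [p pE] := coinduced_map cob (e \oC eva).
have [y' y'E] := coinduced_map cob y.
have I0 := constant_initial zI.
have [i _] := I0 X; have [j _] := I0 Ra.
have [|||h [_ ph]] :=
  @ms_lift_tfib _ M _ _ _ _ i (p : @hom (simplicial A) Ra Rb) (XC _ i I0) _ _ j y'.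
- apply/pms_fib => P PP.
  exact: (projective_hom_trivial_fibration PP eS coa cob pE).1.
- apply/pms_weq => P PP.
  exact: (projective_hom_trivial_fibration PP eS coa cob pE).2.
- exact: initial_eq.
exists (eva \oC (h : smap X Ra) n).
by rewrite compA -pE -compA -y'E -ph.
Qed.

(** * Mapping out of retracts and of values of a left adjoint *)

Definition hom_precomp (C : category) (P W : C) (w : hom P W)
    (Z : simplicial_object C) :
  smap (fcomp (hom_functor W) Z) (fcomp (hom_functor P) Z).
Proof.
by exists (fun n x => x \oC w) => m n t; apply: funext => x /=; rewrite compA.
Defined.

Lemma hom_retract (C : category) (P W : C) (u : hom P W) (v : hom W P)
    (X Y : simplicial C) (f : hom X Y) :
  v \oC u = idm P ->
  retract_of (fmap (sfunctor (hom_functor P)) f)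
             (fmap (sfunctor (hom_functor W)) f).
Proof.
move=> vu.
exists (hom_precomp v X), (hom_precomp u X), (hom_precomp v Y), (hom_precomp u Y).
split; apply: smap_ext => n; apply: funext => x /=;
  by rewrite -?compA ?vu ?compm1.
Qed.

Section HomAdj.
Variables (C D : category) (L : functor D C) (R : functor C D).
Variables (adj : adjunction L R) (P : D).

Definition hom_adj_fwd (Z : simplicial_object C) :
  smap (fcomp (hom_functor (L P)) Z) (fcomp (hom_functor P) (fcomp R Z)).
Proof.
exists (fun n x => adj_fwd adj x) => m n t.
by apply: funext => x /=; rewrite adj_natr.
Defined.

Definition hom_adj_bwd (Z : simplicial_object C) :
  smap (fcomp (hom_functor P) (fcomp R Z)) (fcomp (hom_functor (L P)) Z).
Proof.
exists (fun n x => adj_bwd adj x) => m n t.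
by apply: funext => x /=; rewrite adj_bwd_natr.
Defined.

(** Transposition is an isomorphism of arrows; it is recorded as a retract in each direction because
    the classes of maps involved are closed under retracts. *)
Lemma hom_adj_retractl (X Y : simplicial C) (f : hom X Y) :
  retract_of (fmap (sfunctor (hom_functor P)) (fmap (sfunctor R) f))
             (fmap (sfunctor (hom_functor (L P))) f).
Proof.
exists (hom_adj_bwd X), (hom_adj_fwd X), (hom_adj_bwd Y), (hom_adj_fwd Y).
split; apply: smap_ext => n; apply: funext => x /=;
  by rewrite ?adj_bwdK ?adj_bwd_natr ?adj_natr.
Qed.

Lemma hom_adj_retractr (X Y : simplicial C) (f : hom X Y) :
  retract_of (fmap (sfunctor (hom_functor (L P))) f)
             (fmap (sfunctor (hom_functor P)) (fmap (sfunctor R) f)).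
Proof.
exists (hom_adj_fwd X), (hom_adj_bwd X), (hom_adj_fwd Y), (hom_adj_bwd Y).
split; apply: smap_ext => n; apply: funext => x /=;
  by rewrite ?adj_fwdK ?adj_bwd_natr ?adj_natr.
Qed.

End HomAdj.

(** * The adjunction *)

Section QuasiAbelianAdjunction.
Variables (Q Q' : preadditive) (F : functor Q Q') (F' : functor Q' Q).
Variables (adj : adjunction F' F) (ffF : fully_faithful F).
Variables (z : Q) (zT : terminal z).

(** Fullness makes the zero morphism the image of some map to [z], which can only be [f]. *)
Lemma fmap_to_zero (b : Q) (f : hom b z) : fmap F f = zero_mor (F b) (F z).
Proof.
have [g _ Fg] := ffF b z.
by rewrite -(Fg (zero_mor _ _)); congr fmap; apply: terminal_eq.
Qed.

(** A zero morphism factors through [z], so its transpose factors through [F z], whose identity is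
    zero by [fmap_to_zero]. *)
Lemma adj_bwd_zero (d : Q') (c : Q) :
  adj_bwd adj (zero_mor d (F c)) = zero_mor (F' d) c.
Proof.
have -> : zero_mor (F' d) c = zero_mor z c \oC zero_mor (F' d) z.
  by rewrite zero_mor_compr.
rewrite -[RHS](@adj_fwdK _ _ _ _ adj); congr adj_bwd.
rewrite adj_natr -[adj_fwd _ _]comp1m -fmap1 fmap_to_zero.
by rewrite zero_mor_compr zero_mor_compl.
Qed.

Lemma left_adjoint_projective (P : Q') :
  strictly_exact_functor F -> projective P -> projective (F' P).
Proof.
move=> exF PP a b e /(strictly_exact_to_zero zT)/exF.
(* The image of [e] is [i \oC u] with [u] a strict epimorphism and [i] a kernel of a zero morphism,
   so every map into [F b] factors through [i]. *)
move=> [_ [k [i [u [[_ kU] iu uS]]]]] y.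
have [|y' [iy' _]] := kU _ (adj_fwd adj y).
  by rewrite fmap_to_zero zero_mor_compr.
have [x ux] := PP _ _ _ uS y'.
exists (adj_bwd adj x).
by rewrite -adj_bwd_natr -iu -compA ux iy' adj_fwdK.
Qed.

(** If [e] is a cokernel of [h], its transpose is one of [fmap F' h]: maps killing the latter
    transpose to maps killing [h], which factor through [F c] and descend to [c] by full
    faithfulness. *)
Lemma adj_bwd_strict_epi (P : Q') (c : Q) (e : hom P (F c)) :
  strict_epi e -> strict_epi (adj_bwd adj e).
Proof.
move=> eS; have [k [h [eh eU]]] := eS.
exists (F' k), (fmap F' h); split.
  by rewrite -adj_bwd_natl eh adj_bwd_zero.
move=> m g gh.
have [|w [we _]] := eU _ (adj_fwd adj g).
  by rewrite -adj_natl gh -adj_bwd_zero adj_bwdK.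
have [r rK Fr] := ffF c m.
exists (r w); split=> [|v vg].
  by rewrite -adj_bwd_natr Fr we adj_fwdK.
rewrite -(rK v); congr r; apply: (strict_epi_cancel eS).
by rewrite we -vg adj_natr adj_bwdK.
Qed.

(** A projective cover of [F P] transposes to a strict epimorphism onto [P], which splits. *)
Lemma projective_retract (P : Q) :
  enough_projectives Q' -> projective P ->
  exists (P' : Q') (u : hom P (F' P')) (v : hom (F' P') P),
    projective P' /\ v \oC u = idm P.
Proof.
move=> epQ' PP; have [P' [e [PP' eS]]] := epQ' (F P).
have [u vu] := PP _ _ _ (adj_bwd_strict_epi eS) (idm P).
by exists P', u, (adj_bwd adj e).
Qed.

End QuasiAbelianAdjunction.

Theorem proposition20 (Q Q' : preadditive)
  (qaQ : quasi_abelian Q) (qaQ' : quasi_abelian Q')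
  (epQ : enough_projectives Q) (epQ' : enough_projectives Q')
  (M : projective_model_structure Q) (M' : projective_model_structure Q')
  (F : functor Q Q') (exF : strictly_exact_functor F) (ffF : fully_faithful F)
  (F' : functor Q' Q) (adj : adjunction F' F)
  (covF : forall q' : Q', exists (q : Q) (e : hom (F q) q'), strict_epi e) :
  quillen_equivalence M M' (sadjunction adj).
Proof.
have [[[z [_ zT]] _] _ _ _ _] := qaQ.
have F'proj P' : projective P' -> projective (F' P').
  exact: (left_adjoint_projective adj ffF zT exF).
have Fweq (X Y : simplicial Q) (f : hom X Y) :
    weq M f <-> weq M' (fmap (sfunctor F) f).
  split=> /pms_weq fW; apply/pms_weq => P PP.
    exact: sset_weq_retract (hom_adj_retractl adj P f) (fW _ (F'proj _ PP)).
  have [P' [u [v [PP' vu]]]] := projective_retract adj ffF zT epQ' PP.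
  apply: (sset_weq_retract (hom_retract f vu)).
  exact: sset_weq_retract (hom_adj_retractr adj P' f) (fW _ PP').
split.
  apply: (quillen_adjunction_right (sadjunction adj)) => X Y f.
    move=> /pms_fib fF; apply/pms_fib => P PP.
    exact: kan_fibration_retract (hom_adj_retractl adj P f) (fF _ (F'proj _ PP)).
  by move=> /Fweq.
move=> X Y f XC _.
pose eta : smap X (fcomp F (fcomp F' X)) :=
  adj_fwd (sadjunction adj) (idm (sfunctor F' X)).
have etaW : weq M' (eta : hom X (sfunctor F (sfunctor F' X))).
  have [n|r [rK Kr]] := smap_iso (f := eta); last exact: weq_iso rK Kr.
  have [q [e eS]] := covF (X n).
  have [s es] := strict_epi_split (cofibrant_projective (n := n) qaQ' XC) eS.
  exact: unit_retract_iso es.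
(* The transpose of [f] is its image under [F] after the unit, so two-out-of-three applies. *)
have -> : adj_fwd (sadjunction adj) f = fmap (sfunctor F) f \oC eta.
  by rewrite -adj_natr compm1.
rewrite Fweq; split=> fW; first exact: ms_weq_comp fW.
exact: ms_weq_cancelr etaW fW.
Qed.
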